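(* Let $G$ be a connected real Lie group of dimension $n$, let $R<1$ and let $\phi\in C^\omega(G)$ be a representative function. Then $\phi\in\mathscr E_R(G)$. More precisely, choosing an auxiliary norm $\|\cdot\|$ on the orbit $\langle\phi\rangle$ of $\phi$, one has for all $c\ge0$ the estimate $$q_{R,c}(\phi)\le\Delta\cdot\|\phi\|\sum_{k=0}^\infty k!^{R-1}(c\,\Psi\, n)^k,$$ where $\Psi$ is the maximum of the operator seminorms $$\Psi=\max_{i=1,\dots,n}\ \max_{\psi\in\langle\phi\rangle,\ |\psi(\mathrm e)|\le1}\bigl|(\mathcal L_{X_i}\psi)(\mathrm e)\bigr|$$ of the Lie derivatives in direction of left-invariant vector fields on the orbit $\langle\phi\rangle$ of $\phi$, and $\Delta$ is the operator norm of the Dirac functional at the group unit $\mathrm e$, i.e. $$\Delta=\max_{\psi\in B_1(0)^{\mathrm{cl}}}|\psi(\mathrm e)|,$$ with $B_1(0)^{\mathrm{cl}}$ the closed unit ball of $\langle\phi\rangle$ with respect to $\|\cdot\|$.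
   Context: All functions are complex-valued. $G$ is a connected real Lie group of dimension $n$ with unit $\mathrm e$, Lie algebra $\mathfrak g$ and fixed basis $(e_1,\dots,e_n)$ of $\mathfrak g$; $X_i$ is the left-invariant vector field with $X_i(\mathrm e)=e_i$, $\mathcal L_X$ is the Lie derivative, and $\ell_g(h)=gh$, $r_g(h)=hg$ are the left and right multiplications. For $\alpha\in\{1,\dots,n\}^k$ put $\mathcal L_{X_\alpha}=\mathcal L_{X_{\alpha_1}}\cdots\mathcal L_{X_{\alpha_k}}$. For $R\in\mathbb R$, $c\ge0$ and $\phi\in C^\infty(G)$ set $$q_{R,c}(\phi)=\sum_{k=0}^\infty k!^{R-1}c^k\sum_{\alpha\in\{1,\dots,n\}^k}\bigl|(\mathcal L_{X_\alpha}\phi)(\mathrm e)\bigr|\in[0,\infty],$$ and $\mathscr E_R(G)=\{\phi\in C^\omega(G): q_{R,c}(\phi)<\infty\ \text{for all } c\ge0\}$, where $C^\omega(G)$ denotes the real-analytic functions on $G$. The representative functions (matrix coefficients) on $G$ are generated by the functions $g\mapsto\pi(g)_{ij}$, where $\pi$ ranges over all continuous (and thus automatically analytic) finite-dimensional representations of $G$. For a representative function $\phi$, $\langle\phi\rangle=\{\ell_g^*\phi\in C^\omega(G): g\in G\}$ denotes the orbit of $\phi$ under the left action of $G$ on itself; the source recalls as well known that $\langle\phi\rangle$ is finite-dimensional, coincides with the orbit $\{r_g^*\phi: g\in G\}$ under right translations, and contains the Lie derivatives of $\phi$ in direction of left-invariant vector fields.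
   Formalization: The maximum defining Ψ need not exist (G=ℝ, φ=sin: ψ=t·sin has ψ(0)=0, ψ'(0)=t), so Ψ and Δ are read as suprema in [0,∞] with 0·∞=0, and the estimate may have an infinite right-hand side; the orbit ⟨φ⟩ is read as the complex linear span of the left translates. *)

(* Defs.v *)
From HB Require Import structures.
From mathcomp Require Import all_boot all_order all_algebra.
From mathcomp Require Import all_classical all_reals all_analysis.
From mathcomp Require Export complex.

Set Implicit Arguments.
Unset Strict Implicit.
Unset Printing Implicit Defensive.

Import Order.TTheory GRing.Theory Num.Theory.
Import numFieldNormedType.Exports.
Import ComplexField.Normc.

Local Open Scope classical_set_scope.
Local Open Scope complex_scope.
Local Open Scope ring_scope.

(* Real-analyticity in several variables: near a, f is the sum of an absolutely
   convergent power series \sum_(alpha in nat^m) a_alpha (x - a)^alpha, grouped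
   by the total degree k of alpha; a multi-index of total degree k has all its
   entries below k.+1. *)
Section analytic_rV.
Context {K : realType} {m : nat}.
Implicit Types (a x : 'rV[K]_m) (coef : ('I_m -> nat) -> K).

Definition monomial_term coef x (alpha : 'I_m -> nat) : K :=
  coef alpha * \prod_(i < m) x ord0 i ^+ alpha i.

Definition degree_sum (F : ('I_m -> nat) -> K) (k : nat) : K :=
  \sum_(alpha : {ffun 'I_m -> 'I_k.+1} | (\sum_(i < m) alpha i == k)%N)
    F (fun i => nat_of_ord (alpha i)).

Definition analytic_at (f : 'rV[K]_m -> K) a : Prop :=
  exists coef, \forall x \near a,
    cvgn (series (degree_sum (fun alpha =>
            `|monomial_term coef (x - a) alpha|))) /\
    series (degree_sum (monomial_term coef (x - a))) @ \oo --> f x.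

Definition analytic_map_at (p : nat) (F : 'rV[K]_m -> 'rV[K]_p) a : Prop :=
  forall j : 'I_p, analytic_at (fun x => F x ord0 j) a.

End analytic_rV.

(* cmap and cinv are total functions, meaningful only on cdom and on its image
   respectively. *)
Record chart (K : realType) (n : nat) (G : topologicalType) := Chart {
  cdom : set G;
  cmap : G -> 'rV[K]_n;
  cinv : 'rV[K]_n -> G;
  cdom_open : open cdom;
  cimg_open : open (cmap @` cdom);
  cmapK : forall x, cdom x -> cinv (cmap x) = x;
  cmap_continuous : {within cdom, continuous cmap};
  cinv_continuous : {within cmap @` cdom, continuous cinv} }.

(* Lie groups are taken with their real-analytic structure; every smooth Lie
   group carries exactly one compatible one. *)
HB.mixin Record Group_isLie (K : realType) (n : nat) G
    of Group G & Topological G := {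
  atlas : set (chart K n G);
  atlas_cover : forall x : G, exists c, atlas c /\ cdom c x;
  atlas_analytic : forall c d, atlas c -> atlas d ->
    forall x, cdom c x -> cdom d x ->
    analytic_map_at (cmap d \o cinv c) (cmap c x);
  lie_hausdorff : hausdorff_space G;
  lie_second_countable : @second_countable G;
  mulg_continuous : continuous (fun xy : G * G => (xy.1 * xy.2)%g);
  mulg_analytic : forall c d e, atlas c -> atlas d -> atlas e ->
    forall x y, cdom c x -> cdom d y -> cdom e (x * y)%g ->
    analytic_map_at
      (fun u : 'rV[K]_(n + n) =>
         cmap e (cinv c (lsubmx u) * cinv d (rsubmx u))%g)
      (row_mx (cmap c x) (cmap d y));
  invg_continuous : continuous (fun x : G => (x^-1)%g);
  invg_analytic : forall c d, atlas c -> atlas d ->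
    forall x, cdom c x -> cdom d (x^-1)%g ->
    analytic_map_at (fun u => cmap d ((cinv c u)^-1)%g) (cmap c x) }.

#[short(type="lieGroupType")]
HB.structure Definition LieGroup (K : realType) (n : nat) :=
  {G of Group_isLie K n G & Group G & Topological G}.

Section lie_group.
Context {K : realType} {n : nat} {G : lieGroupType K n}.
Implicit Types (c d : chart K n G) (g h : G) (f phi psi : G -> K[i]).

Definition chart_at c g : Prop := atlas c /\ cdom c g.

Definition some_chart g : chart K n G := projT1 (cid (atlas_cover g)).

(* A tangent vector is a family of coordinate vectors, one for each chart at
   the point, related by the differentials of the changes of charts; the values
   of tcoord at other charts carry no meaning. *)
Record tangent g := Tangent {
  tcoord : chart K n G -> 'rV[K]_n;
  tcoord_change : forall c d, chart_at c g -> chart_at d g ->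
    tcoord d = 'd (cmap d \o cinv c) (cmap c g) (tcoord c) }.

Definition tangent_basis g (e : 'I_n -> tangent g) : Prop :=
  forall v : tangent g, exists! a : 'rV[K]_n,
    forall c, chart_at c g ->
      tcoord v c = \sum_(i < n) a ord0 i *: tcoord (e i) c.

Definition vector_field := forall g, tangent g.

(* The differential of the left multiplication by g maps X h to X (g h). *)
Definition left_invariant (X : vector_field) : Prop :=
  forall g h c d, chart_at c h -> chart_at d (g * h)%g ->
    tcoord (X (g * h)%g) d =
    'd (fun u => cmap d (g * cinv c u)%g) (cmap c h) (tcoord (X h) c).

Definition analytic_fun f : Prop :=
  forall c g, chart_at c g ->
    analytic_at (fun u => complex.Re (f (cinv c u))) (cmap c g) /\
    analytic_at (fun u => complex.Im (f (cinv c u))) (cmap c g).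

(* For f differentiable at g the value does not depend on the chart. *)
Definition lie_derivative (X : vector_field) f : G -> K[i] := fun g =>
  let c := some_chart g in
  let v := tcoord (X g) c in
  ('D_v (fun u => complex.Re (f (cinv c u))) (cmap c g)) +i*
  ('D_v (fun u => complex.Im (f (cinv c u))) (cmap c g)).

Definition lie_derivatives (X : 'I_n -> vector_field) (alpha : seq 'I_n) f :=
  foldr (fun i => lie_derivative (X i)) f alpha.

Definition qnorm (X : 'I_n -> vector_field) (r c : K) f : \bar K :=
  (\sum_(0 <= k <oo)
    ((k`!%:R `^ (r - 1)) * c ^+ k *
     \sum_(alpha : k.-tuple 'I_n) normc (lie_derivatives X alpha f 1%g))%:E)%E.

Definition entire (X : 'I_n -> vector_field) (r : K) : set (G -> K[i]) :=
  [set f | analytic_fun f /\ forall c : K, 0 <= c -> (qnorm X r c f < +oo)%E].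

Definition continuousC f : Prop :=
  continuous (fun g => complex.Re (f g)) /\ continuous (fun g => complex.Im (f g)).

Definition representation (m : nat) (pi : G -> 'M[K[i]]_m) : Prop :=
  [/\ pi 1%g = 1%:M,
      forall g h, pi (g * h)%g = pi g *m pi h
    & forall i j, continuousC (fun g => pi g i j)].

(* The algebra generated by the matrix coefficients. Sums and tensor products
   of representations make it equal to their linear span. *)
Inductive representative : (G -> K[i]) -> Prop :=
| representative_coef m (pi : G -> 'M[K[i]]_m) i j :
    representation pi -> representative (fun g => pi g i j)
| representative_add f1 f2 : representative f1 -> representative f2 ->
    representative (fun g => f1 g + f2 g)
| representative_scale (a : K[i]) f : representative f ->
    representative (fun g => a * f g)
| representative_mul f1 f2 : representative f1 -> representative f2 ->
    representative (fun g => f1 g * f2 g).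

(* The vector space <phi>: the complex linear span of the left translates
   h |-> phi (g h). *)
Definition orbit_space phi : set (G -> K[i]) :=
  [set psi | exists (m : nat) (a : 'I_m -> K[i]) (g : 'I_m -> G),
     psi = fun h => \sum_(j < m) a j * phi (g j * h)%g].

Definition norm_on (V : set (G -> K[i])) (N : (G -> K[i]) -> K) : Prop :=
  [/\ forall psi, V psi -> 0 <= N psi,
      forall psi, V psi -> N psi = 0 -> psi = (fun=> 0),
      forall a psi, V psi -> N (fun g => a * psi g) = normc a * N psi
    & forall psi1 psi2, V psi1 -> V psi2 ->
        N (fun g => psi1 g + psi2 g) <= N psi1 + N psi2].

(* A supremum in [0, +oo]: it is +oo as soon as some psi in <phi> vanishes at
   the unit while its derivative there does not. *)
Definition Psi (X : 'I_n -> vector_field) phi : \bar K :=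
  \big[maxe/0%E]_(i < n)
    ereal_sup [set (normc (lie_derivative (X i) psi 1%g))%:E | psi in
                 orbit_space phi `&` [set psi | normc (psi 1%g) <= 1]].

Definition Delta (N : (G -> K[i]) -> K) phi : \bar K :=
  ereal_sup [set (normc (psi 1%g))%:E | psi in
               orbit_space phi `&` [set psi | N psi <= 1]].

End lie_group.

Arguments vector_field {K n} G.

(* Main.v *)
(* The iterated Lie derivatives of phi at 1 grow at most geometrically: phi (g h)
   is a kernel of finite rank on G x G, so finitely many right translates u_k of
   phi form a row vector with X_i u = u A_i for constant matrices A_i, and phi is
   a constant combination of the u_k. Against k! ^ (r - 1) with r < 1 this makes
   the seminorms finite.

   The span <phi> of the left translates need not be stable under the
   left-invariant fields X_i, whose flows are right translations. The explicit
   estimate distinguishes two cases instead. If Psi = +oo, its right-hand side is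
   +oo, apart from degenerate cases. If Psi is finite, then psi(1) = 0 implies
   (X_i psi)(1) = 0 on <phi>, so phi is a common eigenfunction of the X_i, with
   eigenvalues bounded by Psi. *)
Require Import Defs.
From mathcomp Require Import all_boot all_order all_algebra.
From mathcomp Require Import all_classical all_reals all_analysis.
From mathcomp Require Import ring lra.

Set Implicit Arguments.
Unset Strict Implicit.
Unset Printing Implicit Defensive.

Import Order.TTheory GRing.Theory Num.Theory.
Import numFieldNormedType.Exports.
Import ComplexField.Normc.

Local Open Scope classical_set_scope.
Local Open Scope ring_scope.

(** * Analytic functions are differentiable *)

(** The bound forces [f a = 0] and is [o(|x - a|)], so the zero map is the differential. It handles
    remainders of power series and, with [C = 0], differences of functions that agree near a
    point. *)
Lemma differentiable_quadratic (K : realType) (V W : normedModType K)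
    (f : V -> W) (a : V) (C : K) :
  (\forall x \near a, `|f x| <= C * `|x - a| ^+ 2) -> differentiable f a.
Proof.
move=> fC.
have fa : f a = 0.
  have := nbhs_singleton fC.
  by rewrite subrr normr0 expr0n mulr0 normr_le0 => /eqP.
(* The sign of [C] is not known; [|C| + 1] is a positive bound by which one can divide. *)
have C0 : 0 < `|C| + 1 by rewrite ltr_wpDl.
have df : f \o shift a = cst (f a) + (\0 : {linear V -> W}) +o_ 0 id.
  apply/eqaddoP => _/posnumP[eps].
  have : \forall x \near (0 : V), `|f (x + a)| <= C * `|x| ^+ 2.
    move: fC; rewrite (near_shift 0) subr0 => fC.
    by apply: filterS fC => x; rewrite /= addrK.
  move=> fC'.
  have e1 : 0 < eps%:num / (`|C| + 1) by rewrite divr_gt0.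
  apply: filterS2 fC' (nbhs0_le e1) => x fCx xe.
  rewrite /= fa opprD addrA /GRing.add /GRing.opp /= /GRing.zero/= !oppr0 !addr0.
  apply: (le_trans fCx); apply: (@le_trans _ _ ((`|C| + 1) * `|x| ^+ 2)).
    by rewrite ler_wpM2r// (le_trans (ler_norm _))// lerDl.
  by rewrite expr2 mulrA ler_wpM2r// mulrC -ler_pdivlMr.
have cont0 : continuous (\0 : {linear V -> W}) by move=> ?; exact: cvg_cst.
have dE := diff_unique cont0 df.
apply/diff_locallyP; split; rewrite dE //.
Qed.

Lemma differentiable_prod (K : realType) (V : normedModType K) (I : Type)
    (s : seq I) (P : pred I) (f : I -> V -> K) (a : V) :
  (forall i, differentiable (f i) a) ->
  differentiable (fun x => \prod_(i <- s | P i) f i x) a.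
Proof.
move=> df; elim: s => [|i s IH].
  rewrite (_ : (fun _ => _) = cst 1); first exact: differentiable_cst.
  by apply/funext => x; rewrite big_nil.
case: (boolP (P i)) => Pi.
  rewrite (_ : (fun _ => _) = f i * (fun x => \prod_(i <- s | P i) f i x)).
    exact: differentiableM.
  by apply/funext => x; rewrite big_cons Pi.
by under eq_fun do rewrite big_cons (negbTE Pi).
Qed.

Lemma differentiable_bigsum (K : realType) (V W : normedModType K) (I : Type)
    (s : seq I) (P : pred I) (f : I -> V -> W) (a : V) :
  (forall i, differentiable (f i) a) ->
  differentiable (fun x => \sum_(i <- s | P i) f i x) a.
Proof.
move=> df; elim: s => [|i s IH].
  rewrite (_ : (fun _ => _) = cst 0); first exact: differentiable_cst.
  by apply/funext => x; rewrite big_nil.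
case: (boolP (P i)) => Pi.
  rewrite (_ : (fun _ => _) = f i + (fun x => \sum_(i <- s | P i) f i x)).
    exact: differentiableD.
  by apply/funext => x; rewrite big_cons Pi.
by under eq_fun do rewrite big_cons (negbTE Pi).
Qed.

Section analytic_differentiable.
Context {K : realType} {m : nat}.
Implicit Types (a x y : 'rV[K]_m) (coef : ('I_m -> nat) -> K).

Lemma differentiable_degree_sum coef k a x0 :
  differentiable (fun x => degree_sum (monomial_term coef (x - a)) k) x0.
Proof.
apply: differentiable_bigsum => al.
rewrite (_ : (fun _ => _) =
  coef (fun i => al i) *: (fun x => \prod_(i < m) (x - a) ord0 i ^+ al i)) //.
apply: differentiableZ; apply: differentiable_prod => i.
rewrite (_ : (fun _ => _) =
  (fun x => \prod_(j < al i) (fun y : 'rV[K]_m => (y - a) ord0 i) x)).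
  apply: differentiable_prod => _.
  rewrite (_ : (fun _ => _) =
    (fun y : 'rV[K]_m => y ord0 i) \- cst (a ord0 i)).
    by apply: differentiableB => //; exact: differentiable_coord.
  by apply/funext => y; rewrite !mxE.
by apply/funext => x; rewrite prodr_const card_ord.
Qed.

(** Every monomial of degree [k] scales by [t ^+ k], so its size on the cube of half-side [t * rho]
    is controlled by its value at the corner [const_mx rho]. *)
Lemma ler_degree_sum coef k x (t rho : K) : 0 <= t -> 0 < rho ->
  (forall i, `|x ord0 i| <= t * rho) ->
  `|degree_sum (monomial_term coef x) k| <=
  t ^+ k * degree_sum (fun al => `|monomial_term coef (const_mx rho) al|) k.
Proof.
move=> t0 rho0 xt; rewrite /degree_sum mulr_sumr.
apply: (le_trans (ler_norm_sum _ _ _)); apply: ler_sum => al /eqP alk.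
rewrite /monomial_term !normrM !normr_prod mulrCA ler_wpM2l//.
have -> : t ^+ k = \prod_(i < m) t ^+ al i by rewrite prodrXr alk.
rewrite -big_split/=; apply: ler_prod => i _.
rewrite normr_ge0/= !normrX mxE (gtr0_norm rho0) -exprMn.
by rewrite lerXn2r ?nnegrE ?mulr_ge0// ltW.
Qed.

Lemma degree_sum_ge0 (F : ('I_m -> nat) -> K) k :
  (forall al, 0 <= F al) -> 0 <= degree_sum F k.
Proof. by move=> F0; apply: sumr_ge0. Qed.

(** The terms of degree 0 and 1 form a polynomial; the rest of the series is [O(|x - a|^2)] by
    absolute convergence at one corner of a small cube. *)
Lemma analytic_differentiable (f : 'rV[K]_m -> K) a :
  analytic_at f a -> differentiable f a.
Proof.
move=> [coef fa].
pose P k x := degree_sum (monomial_term coef (x - a)) k.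
have [rho rho0 fball] : exists2 rho : K, 0 < rho & forall x, `|x - a| <= rho ->
    cvgn (series (degree_sum (fun al => `|monomial_term coef (x - a) al|))) /\
    series (fun k => P k x) @ \oo --> f x.
  (* Halving the radius gives a closed ball, which for the max norm contains the corner
     [a + const_mx rho]. *)
  have /nbhs_ballP[e /= e0 He] := fa; exists (e / 2); first by rewrite divr_gt0.
  move=> x xa; apply: He; rewrite -ball_normE/= distrC.
  by rewrite (le_lt_trans xa)// ltr_pdivrMr// ltr_pMr// ltr1n.
pose A k := degree_sum (fun al => `|monomial_term coef (const_mx rho) al|) k.
have A0 k : 0 <= A k by exact: degree_sum_ge0.
have cvgA : cvgn (series A).
  have := (fball (const_mx rho + a)); rewrite addrK => /(_ _)[]//.
  rewrite [X in X <= _]mx_normrE; apply/bigmax_leP; split; first exact: ltW.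
  by move=> i _; rewrite mxE (gtr0_norm rho0).
pose S := limn (series A).
have SA N : series A N <= S.
  by apply: nondecreasing_cvgn_le => //; apply: nondecreasing_series.
rewrite (_ : f = (fun x => \sum_(k < 2) P k x) +
                 (fun x => f x - \sum_(k < 2) P k x)); last first.
  by apply/funext => x; rewrite /GRing.add/= addrC subrK.
apply: differentiableD.
  apply: differentiable_bigsum => k; exact: differentiable_degree_sum.
apply: (@differentiable_quadratic _ _ _ _ _ (S / rho ^+ 2)).
have : \forall x \near a, `|x - a| <= rho.
  by near=> x; rewrite distrC; near: x; exact: cvgr_dist_le.
apply: filterS => x xa.
have [_ cvf] := fball x xa.
have t1 : `|x - a| / rho <= 1 by rewrite ler_pdivrMr// mul1r.
have t0 : 0 <= `|x - a| / rho by rewrite divr_ge0// ltW.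
have Pk k : `|P k x| <= (`|x - a| / rho) ^+ k * A k.
  apply: ler_degree_sum => // i; rewrite divfK ?gt_eqF//.
  rewrite [X in _ <= X]mx_normrE.
  exact: (le_bigmax _ (fun ij => `|(x - a) ij.1 ij.2|) (ord0, i)).
have cvg2 : `|series (fun k => P k x) N - \sum_(k < 2) P k x| @[N --> \oo]
    --> `|f x - \sum_(k < 2) P k x|.
  by apply: cvg_norm; apply: cvgB => //; exact: cvg_cst.
(* The tail is bounded through its partial sums: with [t = |x - a| / rho <= 1], each term of index
   [k >= 2] is at most [t ^+ 2 * A k], and the [A k] sum to at most [S]. *)
rewrite -(cvg_lim (@norm_hausdorff _ _) cvg2); apply: limr_le.
  by apply: cvgP cvg2.
near=> N.
have N2 : (2 <= N)%N by near: N; exact: nbhs_infty_ge.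
rewrite /series/= (big_cat_nat (n := 2))//= big_mkord addrAC subrr add0r.
apply: (le_trans (ler_norm_sum _ _ _)).
apply: (@le_trans _ _ (\sum_(2 <= k < N) (`|x - a| / rho) ^+ 2 * A k)).
  rewrite big_nat [leRHS]big_nat; apply: ler_sum => k /andP[k2 _].
  apply: (le_trans (Pk k)); rewrite ler_wpM2r// -(subnK k2) exprD.
  by rewrite ler_piMl ?exprn_ge0// exprn_ile1.
rewrite -mulr_sumr expr_div_n [leRHS]mulrAC [leLHS]mulrC mulrA.
apply: ler_wpM2r; first by rewrite invr_ge0 exprn_ge0// ltW.
apply: ler_wpM2r; first exact: exprn_ge0.
apply: le_trans (SA N); rewrite /series/= [leRHS](big_cat_nat (n := 2))//=.
by rewrite lerDr sumr_ge0.
Unshelve. all: by end_near. Qed.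

End analytic_differentiable.

Lemma differentiable_rV (K : realType) (V : normedModType K) (p : nat)
    (F : V -> 'rV[K]_p) (a : V) :
  (forall j, differentiable (fun x => F x ord0 j) a) -> differentiable F a.
Proof.
move=> dF.
rewrite (_ : F = fun x => \sum_j F x ord0 j *: delta_mx ord0 j).
  by apply: differentiable_bigsum => j; exact: differentiableZl.
by apply/funext => x; exact: row_sum_delta.
Qed.

Lemma analytic_map_differentiable (K : realType) (m p : nat)
    (F : 'rV[K]_m -> 'rV[K]_p) a : analytic_map_at F a -> differentiable F a.
Proof.
by move=> Fa; apply: differentiable_rV => j; exact: analytic_differentiable.
Qed.

Lemma differentiable_row_mxl (K : realType) (n1 n2 : nat) (b : 'rV[K]_n2)
    (u : 'rV[K]_n1) : differentiable (fun x => row_mx x b) u.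
Proof.
apply: differentiable_rV => j; case: (split_ordP j) => k ->.
  rewrite (_ : (fun _ => _) = (fun x : 'rV[K]_n1 => x ord0 k)).
    exact: differentiable_coord.
  by apply/funext => x; rewrite row_mxEl.
rewrite (_ : (fun _ => _) = cst (b ord0 k)); first exact: differentiable_cst.
by apply/funext => x; rewrite row_mxEr.
Qed.

Lemma differentiable_row_mxr (K : realType) (n1 n2 : nat) (a : 'rV[K]_n1)
    (u : 'rV[K]_n2) : differentiable (fun x => row_mx a x) u.
Proof.
apply: differentiable_rV => j; case: (split_ordP j) => k ->; last first.
  rewrite (_ : (fun _ => _) = (fun x : 'rV[K]_n2 => x ord0 k)).
    exact: differentiable_coord.
  by apply/funext => x; rewrite row_mxEr.
rewrite (_ : (fun _ => _) = cst (a ord0 k)); first exact: differentiable_cst.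
by apply/funext => x; rewrite row_mxEl.
Qed.

Lemma near_eq_differentiable (K : realType) (V W : normedModType K)
    (f g : V -> W) (a : V) :
  (\forall x \near a, f x = g x) -> differentiable f a -> differentiable g a.
Proof.
move=> fg df.
rewrite (_ : g = f + (fun x => g x - f x)); last first.
  by apply/funext => x; rewrite /GRing.add/= addrC subrK.
apply: differentiableD => //.
apply: (@differentiable_quadratic _ _ _ _ _ 0).
by apply: filterS fg => x ->; rewrite subrr normr0 mul0r.
Qed.

(** * Differentiable functions on a Lie group *)

Section chart_calculus.
Context {K : realType} {n : nat} {G : lieGroupType K n}.
Implicit Types (c d : chart K n G) (g h : G) (p : G -> K).

Definition differentiable_fun p : Prop :=
  forall c g, chart_at c g -> differentiable (p \o cinv c) (cmap c g).

Lemma cinv_continuous_at c h : cdom c h -> {for cmap c h, continuous (cinv c)}.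
Proof.
move=> ch; have chi : (cmap c @` cdom c) (cmap c h) by exists h.
have := @cinv_continuous _ _ _ c.
rewrite (continuous_open_subspace _ (@cimg_open _ _ _ c)).
by apply; rewrite inE.
Qed.

Lemma near_cdom c d (q : G -> G) h : cdom c h -> cdom d (q h) ->
  {for h, continuous q} -> \forall u \near cmap c h, cdom d (q (cinv c u)).
Proof.
move=> ch dqh cq.
have : {for cmap c h, continuous (q \o cinv c)}.
  apply: continuous_comp; first exact: cinv_continuous_at.
  by rewrite cmapK.
move=> /(_ (cdom d)); apply; rewrite /= cmapK//.
by apply: open_nbhs_nbhs; split => //; exact: cdom_open.
Qed.

Lemma mulgl_continuous g : continuous (fun h : G => (g * h)%g).
Proof.
move=> h; apply: (@continuous_comp _ _ _ (fun h => (g, h))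
  (fun xy => xy.1 * xy.2)%g).
  by apply: cvg_pair => //=; exact: cvg_cst.
exact: mulg_continuous.
Qed.

Lemma mulgr_continuous g : continuous (fun h : G => (h * g)%g).
Proof.
move=> h; apply: (@continuous_comp _ _ _ (fun h => (h, g))
  (fun xy => xy.1 * xy.2)%g).
  by apply: cvg_pair => //=; exact: cvg_cst.
exact: mulg_continuous.
Qed.

Lemma some_chartP g : chart_at (some_chart g) g.
Proof. by rewrite /some_chart; case: cid. Qed.

(** Left translation is the analytic multiplication map restricted to the slice whose first block is
    the coordinate vector of [g]. *)
Lemma mulgl_differentiable g h c d : chart_at c h -> chart_at d (g * h)%g ->
  differentiable (fun u => cmap d (g * cinv c u)%g) (cmap c h).
Proof.
move=> [ac ch] [ad dh]; have [ae eg] := some_chartP g.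
have /analytic_map_differentiable dm := mulg_analytic _ _ _ ae ac ad _ _ eg ch dh.
have := differentiable_comp (differentiable_row_mxr _ _) dm.
rewrite (_ : _ \o _ = fun u => cmap d (g * cinv c u)%g)//.
by apply/funext => u /=; rewrite row_mxKl row_mxKr cmapK.
Qed.

Lemma mulgr_differentiable g h c d : chart_at c h -> chart_at d (h * g)%g ->
  differentiable (fun u => cmap d (cinv c u * g)%g) (cmap c h).
Proof.
move=> [ac ch] [ad dh]; have [ae eg] := some_chartP g.
have /analytic_map_differentiable dm := mulg_analytic _ _ _ ac ae ad _ _ ch eg dh.
have := differentiable_comp (differentiable_row_mxl _ _) dm.
rewrite (_ : _ \o _ = fun u => cmap d (cinv c u * g)%g)//.
by apply/funext => u /=; rewrite row_mxKl row_mxKr cmapK.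
Qed.

(** Inserting the chart [d] between [q] and [p] is harmless only where [q] lands in the domain of
    [d], so the two expressions are compared on a neighbourhood. *)
Lemma near_chart_comp p (q : G -> G) c d h : cdom c h -> cdom d (q h) ->
  {for h, continuous q} -> \forall u \near cmap c h,
    ((p \o cinv d) \o (fun u => cmap d (q (cinv c u)))) u = p (q (cinv c u)).
Proof.
by move=> ch dh cq; apply: filterS (near_cdom ch dh cq) => u du /=; rewrite cmapK.
Qed.

Lemma differentiable_fun_comp p (q : G -> G) : continuous q ->
  (forall c d h, chart_at c h -> chart_at d (q h) ->
     differentiable (fun u => cmap d (q (cinv c u))) (cmap c h)) ->
  differentiable_fun p -> differentiable_fun (p \o q).
Proof.
move=> cq dq dp c h ch; have dh := some_chartP (q h).
apply: near_eq_differentiable (near_chart_comp p ch.2 dh.2 (cq h)) _.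
apply: differentiable_comp; first exact: dq.
by rewrite cmapK; [exact: dp|exact: ch.2].
Qed.

(** The chain rule moves the translation from the function to the tangent vector, in exactly the
    form used by [left_invariant]. *)
Lemma derive_mulgl p c d g h v : differentiable_fun p ->
  chart_at c h -> chart_at d (g * h)%g ->
  'D_v (fun u => p (g * cinv c u)%g) (cmap c h) =
  'D_('d (fun u => cmap d (g * cinv c u)%g) (cmap c h) v)
     (p \o cinv d) (cmap d (g * h)%g).
Proof.
move=> dp ch dh.
have dm := mulgl_differentiable ch dh.
have dpd := dp _ _ dh.
have ne := near_chart_comp p ch.2 dh.2 (@mulgl_continuous g h).
have dpd' : differentiable (p \o cinv d) (cmap d (g * cinv c (cmap c h))%g).
  by rewrite cmapK; last exact: ch.2.
rewrite -(near_eq_derive _ ne) deriveE; last exact: differentiable_comp.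
by rewrite diff_comp//= cmapK ?deriveE//; exact: ch.2.
Qed.

End chart_calculus.

(** The real and imaginary parts of a sum or of a complex multiple are real linear combinations of
    two functions, so this one form serves both. *)
Lemma derive_lincomb (K : realType) (V : normedModType K) (p q : V -> K)
    (a b : K) (x v : V) : derivable p x v -> derivable q x v ->
  'D_v (fun u => a * p u + b * q u) x = a * 'D_v p x + b * 'D_v q x.
Proof.
move=> dp dq; rewrite (_ : (fun _ => _) = a *: p + b *: q)//.
by rewrite deriveD ?deriveZ//; exact: derivableZ.
Qed.

(** * Lie derivatives of complex-valued functions: linearity and left translations *)

Section complex_lie_derivative.
Context {K : realType} {n : nat} {G : lieGroupType K n}.
Implicit Types (c d : chart K n G) (g h : G) (f : G -> K[i]) (X : vector_field G).

Definition differentiableC f : Prop :=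
  differentiable_fun (fun g => complex.Re (f g)) /\
  differentiable_fun (fun g => complex.Im (f g)).

Lemma analytic_fun_differentiableC f : analytic_fun f -> differentiableC f.
Proof.
by move=> af; split=> c g cg; have [fr fi] := af c g cg;
  exact: analytic_differentiable.
Qed.

Lemma differentiableC_mulgl f g :
  differentiableC f -> differentiableC (fun h => f (g * h)%g).
Proof.
have lc := @mulgl_continuous _ _ _ g; have ld := @mulgl_differentiable _ _ _ g.
by move=> [fr fi]; split;
  [apply: (differentiable_fun_comp lc) fr|apply: (differentiable_fun_comp lc) fi];
  move=> c d h; exact: ld.
Qed.

Lemma differentiableC_mulgr f g :
  differentiableC f -> differentiableC (fun h => f (h * g)%g).
Proof.
have lc := @mulgr_continuous _ _ _ g; have ld := @mulgr_differentiable _ _ _ g.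
by move=> [fr fi]; split;
  [apply: (differentiable_fun_comp lc) fr|apply: (differentiable_fun_comp lc) fi];
  move=> c d h; exact: ld.
Qed.

(** By the chain rule the vector [X h] is pushed forward by left translation, and left invariance
    identifies the result with [X (g * h)]. *)
Lemma lie_derivative_mulgl X f g h : left_invariant X -> differentiableC f ->
  lie_derivative X (fun h => f (g * h)%g) h = lie_derivative X f (g * h)%g.
Proof.
move=> Xl [fr fi]; rewrite /lie_derivative.
have ch := some_chartP h; have dh := some_chartP (g * h)%g.
rewrite (derive_mulgl _ fr ch dh) (derive_mulgl _ fi ch dh).
by rewrite (Xl _ _ _ _ ch dh).
Qed.

Lemma ReD (x y : K[i]) : complex.Re (x + y) = complex.Re x + complex.Re y.
Proof. by case: x; case: y. Qed.

Lemma ImD (x y : K[i]) : complex.Im (x + y) = complex.Im x + complex.Im y.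
Proof. by case: x; case: y. Qed.

Lemma ReM (x y : K[i]) : complex.Re (x * y) =
  complex.Re x * complex.Re y - complex.Im x * complex.Im y.
Proof. by case: x; case: y. Qed.

Lemma ImM (x y : K[i]) : complex.Im (x * y) =
  complex.Re x * complex.Im y + complex.Im x * complex.Re y.
Proof. by case: x; case: y. Qed.

Lemma differentiableC_add f1 f2 : differentiableC f1 -> differentiableC f2 ->
  differentiableC (fun g => f1 g + f2 g).
Proof.
move=> [r1 i1] [r2 i2]; split=> c g cg.
  rewrite (_ : _ \o _ = (fun u => complex.Re (f1 (cinv c u))) +
                       (fun u => complex.Re (f2 (cinv c u)))).
    by apply: differentiableD; [exact: r1|exact: r2].
  by apply/funext => u /=; rewrite ReD.
rewrite (_ : _ \o _ = (fun u => complex.Im (f1 (cinv c u))) +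
                     (fun u => complex.Im (f2 (cinv c u)))).
  by apply: differentiableD; [exact: i1|exact: i2].
by apply/funext => u /=; rewrite ImD.
Qed.

Lemma differentiableC_scale a f : differentiableC f ->
  differentiableC (fun g => a * f g).
Proof.
move=> [r1 i1]; split=> c g cg.
  rewrite (_ : _ \o _ = (complex.Re a *: (fun u => complex.Re (f (cinv c u)))) -
                       (complex.Im a *: (fun u => complex.Im (f (cinv c u))))).
    by apply: differentiableB; apply: differentiableZ; [exact: r1|exact: i1].
  by apply/funext => u /=; rewrite ReM.
rewrite (_ : _ \o _ = (complex.Re a *: (fun u => complex.Im (f (cinv c u)))) +
                     (complex.Im a *: (fun u => complex.Re (f (cinv c u))))).
  by apply: differentiableD; apply: differentiableZ; [exact: i1|exact: r1].
by apply/funext => u /=; rewrite ImM.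
Qed.

Lemma lie_derivative_add X f1 f2 : differentiableC f1 -> differentiableC f2 ->
  lie_derivative X (fun g => f1 g + f2 g) =
  fun g => lie_derivative X f1 g + lie_derivative X f2 g.
Proof.
move=> [r1 i1] [r2 i2]; apply/funext => g; rewrite /lie_derivative.
have cg := some_chartP g; set c := some_chart g in cg *.
set v := tcoord _ _.
have d p := @diff_derivable _ _ _ p (cmap c g) v.
rewrite [RHS]/GRing.add/=; congr Complex.
  under eq_fun do rewrite ReD -[complex.Re _]mul1r -[X in _ + X]mul1r.
  by rewrite (derive_lincomb _ _ (d _ _ (r1 c g cg)) (d _ _ (r2 c g cg))) !mul1r.
under eq_fun do rewrite ImD -[complex.Im _]mul1r -[X in _ + X]mul1r.
by rewrite (derive_lincomb _ _ (d _ _ (i1 c g cg)) (d _ _ (i2 c g cg))) !mul1r.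
Qed.

Lemma lie_derivative_scale X a f : differentiableC f ->
  lie_derivative X (fun g => a * f g) = fun g => a * lie_derivative X f g.
Proof.
move=> [r1 i1]; apply/funext => g; rewrite /lie_derivative.
have cg := some_chartP g; set c := some_chart g in cg *.
set v := tcoord _ _.
have d p := @diff_derivable _ _ _ p (cmap c g) v.
have dr := d _ _ (r1 c g cg); have di := d _ _ (i1 c g cg).
case: a => a b; rewrite [RHS]/GRing.mul/=; congr Complex.
  under eq_fun do rewrite ReM -mulNr.
  by rewrite (derive_lincomb _ _ dr di) mulNr.
under eq_fun do rewrite ImM.
by rewrite (derive_lincomb _ _ di dr).
Qed.

Lemma lie_derivative0 X : lie_derivative X (fun=> 0) = fun=> 0.
Proof.
by apply/funext => g; rewrite /lie_derivative !derive_cst.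
Qed.

Lemma differentiableC0 : differentiableC (fun=> 0).
Proof. by split=> c g cg; exact: differentiable_cst. Qed.

Lemma differentiableC_sum (I : Type) (s : seq I) (f : I -> G -> K[i]) :
  (forall i, differentiableC (f i)) ->
  differentiableC (fun g => \sum_(i <- s) f i g).
Proof.
move=> df; elim: s => [|i s IH].
  by under eq_fun do rewrite big_nil; exact: differentiableC0.
under eq_fun do rewrite big_cons.
exact: differentiableC_add.
Qed.

Lemma lie_derivative_sum X (I : Type) (s : seq I) (f : I -> G -> K[i]) :
  (forall i, differentiableC (f i)) ->
  lie_derivative X (fun g => \sum_(i <- s) f i g) =
  fun g => \sum_(i <- s) lie_derivative X (f i) g.
Proof.
move=> df; elim: s => [|i s IH].
  under eq_fun do rewrite big_nil.
  by rewrite lie_derivative0; apply/funext => g; rewrite big_nil.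
under eq_fun do rewrite big_cons.
rewrite lie_derivative_add//; last exact: differentiableC_sum.
by rewrite IH; apply/funext => g; rewrite big_cons.
Qed.

End complex_lie_derivative.

(** * Functions with a finite-rank translation kernel *)

Section finite_rank_kernel.
Context {F : fieldType} {A B : Type}.
Implicit Types (k : A -> B -> F).

(** An arbitrary finite index type lets sums and products of kernels be indexed by sum and product
    types. *)
Definition finite_rank k : Prop :=
  exists (T : finType) (a : T -> A -> F) (b : T -> B -> F),
    forall x y, k x y = \sum_t a t x * b t y.

(* x, y maximize the size of an invertible matrix k (x i) (y j); bordering it
   by one row and one column makes it singular, so the Schur complement is 0. *)
Lemma finite_rank_sampling k : finite_rank k ->
  exists (d : nat) (x : 'I_d -> A) (y : 'I_d -> B) (Q : 'M[F]_d),
  forall x0 y0, k x0 y0 = \sum_i k x0 (y i) * \sum_j Q i j * k (x j) y0.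
Proof.
move=> [T [a [b kE]]].
pose kmx d (x : 'I_d -> A) (y : 'I_d -> B) : 'M[F]_d := \matrix_(i, j) k (x i) (y j).
pose ok d := `[< exists x y, @kmx d x y \in unitmx >].
have ok0 : exists d, ok d.
  exists 0%N; apply/asboolP.
  have x0 (S : Type) : 'I_0 -> S by case.
  by exists (x0 _), (x0 _); rewrite unitmxE det_mx00 unitr1.
(* A sampled matrix factors through the index type [T], so its rank is at most [#|T|]; hence a
   largest invertible sample exists. *)
have okT d : ok d -> (d <= #|T|)%N.
  move=> /asboolP[x [y]]; rewrite -row_full_unit => /eqP rk.
  have kmxE : kmx d x y = (\matrix_(i < d, t < #|T|) a (enum_val t) (x i)) *m
                         (\matrix_(t < #|T|, j < d) b (enum_val t) (y j)).
    apply/matrixP => i j; rewrite !mxE kE.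
    rewrite (reindex _ (onW_bij _ (@enum_val_bij T)))/=.
    by apply: eq_bigr => t _; rewrite !mxE.
  by rewrite -rk kmxE (leq_trans (mxrankM_maxl _ _))// rank_leq_col.
case: (ex_maxnP ok0 okT) => d /asboolP[x [y Pu]] dmax.
exists d, x, y, (invmx (kmx d x y)) => x0 y0.
pose u : 'rV[F]_d := \row_i k x0 (y i).
pose v : 'cV[F]_d := \col_j k (x j) y0.
set P := kmx d x y in Pu *.
(* The Schur complement of [P] in the matrix bordered by [x0] and [y0]; its vanishing is the claimed
   identity with [Q = invmx P]. *)
pose s : 'M[F]_1 := (k x0 y0)%:M - u *m invmx P *m v.
have s0 : s = 0.
  apply/eqP/negPn/negP => s0.
  have : ok (d + 1)%N; last by move=> /dmax; rewrite addn1 ltnn.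
  apply/asboolP.
  pose x' (i : 'I_(d + 1)) := if fintype.split i is inl i then x i else x0.
  pose y' (i : 'I_(d + 1)) := if fintype.split i is inl i then y i else y0.
  exists x', y'.
  (* Block LU factorization: the determinant of the bordered matrix is [\det P * \det s], so
     [s <> 0] would contradict the maximality of [d]. *)
  have -> : kmx _ x' y' = block_mx 1%:M 0 (u *m invmx P) 1%:M *m block_mx P v 0 s.
    rewrite mulmx_block !mul1mx !mul0mx !addr0 mulmxKV//.
    rewrite /s addrC subrK.
    apply/matrixP => i j; rewrite mxE /x' /y'.
    case: (split_ordP i) => i' ->; case: (split_ordP j) => j' ->.
    - by rewrite block_mxEul !mxE.
    - by rewrite block_mxEur !mxE.
    - by rewrite block_mxEdl !mxE.
    - by rewrite block_mxEdr !mxE !ord1 eqxx.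
  rewrite unitmxE det_mulmx det_lblock det_ublock !det1 !mul1r unitrM -unitmxE Pu/=.
  rewrite det_mx11 unitfE; apply: contra_neq s0 => s0.
  by apply/matrixP => i j; rewrite !ord1 s0 mxE.
move: s0; rewrite /s -mulmxA => /matrixP/(_ ord0 ord0).
rewrite !mxE eqxx mulr1n => /eqP; rewrite subr_eq0 => /eqP ->.
apply: eq_bigr => i _; rewrite !mxE; congr (_ * _).
by apply: eq_bigr => j _; rewrite !mxE.
Qed.

End finite_rank_kernel.

(** * Geometric growth of iterated Lie derivatives *)

Section finite_rank_bound.
Context {K : realType} {n : nat} {G : lieGroupType K n}.
Implicit Types (g h : G) (f phi psi : G -> K[i]).

(** For a matrix coefficient, multiplicativity of [pi] is the required expansion; sums, multiples
    and products of functions give sums, multiples and products of kernels. *)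
Lemma representative_finite_rank f :
  representative f -> finite_rank (fun g h : G => f (g * h)%g).
Proof.
elim=> {f}.
- move=> m pi i j [_ piM _].
  exists 'I_m, (fun k g => pi g i k), (fun k g => pi g k j) => g h.
  by rewrite piM mxE.
- move=> f1 f2 _ [T1 [a1 [b1 E1]]] _ [T2 [a2 [b2 E2]]].
  exists (T1 + T2)%type,
    (fun t g => match t with inl t => a1 t g | inr t => a2 t g end),
    (fun t g => match t with inl t => b1 t g | inr t => b2 t g end) => g h.
  by rewrite big_sumType/= E1 E2.
- move=> c f _ [T [a [b E]]].
  exists T, (fun t g => c * a t g), b => g h.
  by rewrite E mulr_sumr; apply: eq_bigr => t _; rewrite mulrA.
- move=> f1 f2 _ [T1 [a1 [b1 E1]]] _ [T2 [a2 [b2 E2]]].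
  exists (T1 * T2)%type, (fun t g => a1 t.1 g * a2 t.2 g),
    (fun t g => b1 t.1 g * b2 t.2 g) => g h.
  rewrite E1 E2 big_distrlr/= pair_big/=.
  by apply: eq_bigr => t _; rewrite mulrACA.
Qed.

Lemma normc_ge0 (z : K[i]) : 0 <= normc z.
Proof. by case: z => a b; exact: sqrtr_ge0. Qed.

Lemma normc_sum (I : Type) (s : seq I) (F : I -> K[i]) :
  normc (\sum_(i <- s) F i) <= \sum_(i <- s) normc (F i).
Proof.
elim: s => [|i s IH]; first by rewrite !big_nil normc0.
by rewrite !big_cons (le_trans (le_normcD _ _))// lerD2l.
Qed.

(** The fields act on the span of the sampled right translates [u k] by constant matrices, so each
    derivative enlarges the [l1] norm of a coefficient vector by a factor of at most [M]. *)
Lemma lie_derivatives_bound (X : 'I_n -> vector_field G) f :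
  (forall i, left_invariant (X i)) -> differentiableC f ->
  finite_rank (fun g h : G => f (g * h)%g) ->
  exists C M : K, [/\ 0 <= C, 0 <= M & forall alpha,
    normc (lie_derivatives X alpha f 1%g) <= C * M ^+ size alpha].
Proof.
move=> Xl df /finite_rank_sampling[d [x [y [Q fE]]]].
pose u k g := f (g * y k)%g.
have du k : differentiableC (u k) by exact: differentiableC_mulgr.
pose A (i : 'I_n) (k l : 'I_d) : K[i] := \sum_j Q k j *
  lie_derivative (X i) (u l) (x j).
pose l1 (w : 'I_d -> K[i]) := \sum_k normc (w k).
have l1_ge0 w : 0 <= l1 w by apply: sumr_ge0 => k _; exact: normc_ge0.
have Lu i l : lie_derivative (X i) (u l) = fun g => \sum_k u k g * A i k l.
  apply/funext => g.
  (* By left invariance the derivative at [g] is that of [h |-> u l (g * h)] at the unit; [fE]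
     expands this function with [g] only in the factors [u k g], which are constant in [h]. *)
  rewrite -{1}(mulg1 g) -lie_derivative_mulgl//.
  rewrite (_ : (fun h => u l (g * h)%g) =
     fun h => \sum_k u k g * \sum_j Q k j * u l (x j * h)%g); last first.
    by apply/funext => h; rewrite /u -mulgA fE;
       under eq_bigr do under eq_bigr do rewrite mulgA.
  have dul j : differentiableC (fun h => u l (x j * h)%g).
    exact: differentiableC_mulgl.
  have dulQ k : differentiableC (fun h => \sum_j Q k j * u l (x j * h)%g).
    by apply: differentiableC_sum => j; exact: differentiableC_scale.
  rewrite lie_derivative_sum; last by move=> k; exact: differentiableC_scale.
  apply: eq_bigr => k _; rewrite lie_derivative_scale//; congr (_ * _).
  rewrite lie_derivative_sum; last by move=> j; exact: differentiableC_scale.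
  apply: eq_bigr => j _; rewrite lie_derivative_scale// lie_derivative_mulgl//.
  by rewrite mulg1.
(* Summing over all [i] makes one constant serve every field. *)
pose M := \sum_i \sum_k \sum_l normc (A i k l).
(* The coefficients of [f] itself, from [fE] with the unit as second argument. *)
pose w0 k := \sum_j Q k j * f (x j * 1)%g.
have LaE alpha : exists2 w, l1 w <= M ^+ size alpha * l1 w0 &
   lie_derivatives X alpha f = fun g => \sum_k u k g * w k.
  elim: alpha => [|i alpha [w wM IH]].
    exists w0; first by rewrite expr0 mul1r.
    by apply/funext => g; rewrite -[in LHS](mulg1 g) /= fE.
  exists (fun k => \sum_l A i k l * w l).
    rewrite /= exprS -mulrA.
    apply: (@le_trans _ _ (M * l1 w)); last first.
      by rewrite ler_wpM2l//; do 3!(apply: sumr_ge0 => ? _); exact: normc_ge0.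
    apply: (@le_trans _ _ (\sum_k \sum_l normc (A i k l) * normc (w l))).
      apply: ler_sum => k _; apply: (le_trans (normc_sum _ _)).
      by apply: ler_sum => l _; rewrite normcM.
    rewrite /M (bigD1 i)//= mulrDl.
    apply: (@le_trans _ _ ((\sum_k \sum_l normc (A i k l)) * l1 w)); last first.
      rewrite lerDl mulr_ge0//; do 3!(apply: sumr_ge0 => ? _); exact: normc_ge0.
    rewrite mulr_suml; apply: ler_sum => k _; rewrite mulr_suml.
    apply: ler_sum => l _; apply: ler_wpM2l; first exact: normc_ge0.
    rewrite /l1 (bigD1 l)//= lerDl; apply: sumr_ge0 => ? _; exact: normc_ge0.
  rewrite /= IH.
  rewrite (_ : (fun g => \sum_k u k g * w k) =
    fun g => \sum_k w k * u k g); last first.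
    by apply/funext => g; under eq_bigr do rewrite mulrC.
  rewrite lie_derivative_sum; last by move=> k; exact: differentiableC_scale.
  apply/funext => g /=.
  under eq_bigr => k _ do rewrite (lie_derivative_scale _ (w k) (du k)) Lu mulr_sumr.
  rewrite exchange_big/=; apply: eq_bigr => k _; rewrite mulr_sumr.
  by apply: eq_bigr => l _; rewrite mulrCA [w l * _]mulrC.
exists (l1 (u^~ 1%g) * l1 w0), M; split; first exact: mulr_ge0.
  by do 3!(apply: sumr_ge0 => ? _); exact: normc_ge0.
move=> alpha; have [w wM ->] := LaE alpha.
rewrite -mulrA [_ * M ^+ _]mulrC.
apply: (@le_trans _ _ (l1 (u^~ 1%g) * l1 w)); last by rewrite ler_wpM2l.
apply: (le_trans (normc_sum _ _)); rewrite /l1 mulr_suml.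
apply: ler_sum => k _; rewrite normcM ler_wpM2l ?normc_ge0//.
by rewrite (bigD1 k)//= lerDl; apply: sumr_ge0 => ? _; exact: normc_ge0.
Qed.

End finite_rank_bound.

(** * The estimate of the seminorms *)

(* With [s = 1 - r] and [D = (2 (B + 1)) `^ s^-1], the bound
   [D ^ k / k! <= e ^ D] raised to the power [s] yields a geometric majorant
   of ratio 1/2. *)
Lemma fact_powR_series_cvg (K : realType) (r B : K) : r < 1 -> 0 <= B ->
  cvgn (series (fun k => k`!%:R `^ (r - 1) * B ^+ k)).
Proof.
move=> r1 B0; pose s := 1 - r; have s0 : 0 < s by rewrite subr_gt0.
pose b := 2 * (B + 1); have b0 : 0 <= b by rewrite mulr_ge0// addr_ge0.
pose D := b `^ s^-1; have D0 : 0 <= D by exact: powR_ge0.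
have Dk k : D ^+ k / k`!%:R <= expR D.
  case: k => [|k]; first by rewrite expr0 fact0 divr1 -[leLHS]expR0 ler_expR.
  by apply: le_trans (expR_ge1Dxn k D0); rewrite lerDr.
apply: (@series_le_cvg _ _ (fun k => expR D `^ s * 2^-1 ^+ k)).
- by move=> k; rewrite mulr_ge0 ?powR_ge0// exprn_ge0.
- by move=> k; rewrite mulr_ge0 ?powR_ge0// exprn_ge0.
- move=> k.
  apply: (@le_trans _ _ ((D ^+ k / k`!%:R) `^ s * 2^-1 ^+ k)); last first.
    apply: ler_wpM2r; first by rewrite exprn_ge0.
    apply: ge0_ler_powR (Dk k); rewrite ?nnegrE ?divr_ge0 ?exprn_ge0 ?expR_ge0//.
    exact: ltW.
  rewrite powRM ?exprn_ge0 ?invr_ge0//.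
  have -> : (D ^+ k) `^ s = b ^+ k.
    rewrite -powR_mulrn// powRAC /D -(powRrM b) mulVf ?gt_eqF// powRr1//.
    by rewrite powR_mulrn.
  rewrite -[r - 1]opprB powRN.
  rewrite -[X in _ <= _ * X `^ _ * _]powR_inv1// -powRrM mulN1r powRN.
  rewrite [leRHS]mulrAC -exprMn [leRHS]mulrC ler_wpM2l ?invr_ge0 ?powR_ge0//.
  by rewrite lerXn2r ?nnegrE ?mulr_ge0//; rewrite /b; lra.
- by apply: is_cvg_geometric_series; rewrite ger0_norm ?invr_ge0// invf_lt1// ltr1n.
Qed.

(** * The orbit space, finiteness of [Psi] and membership in the entire functions *)

Section seminorm_estimate.
Context {K : realType} {n : nat} {G : lieGroupType K n}.
Variables (X : 'I_n -> vector_field G) (phi : G -> K[i]).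
Hypothesis X_left_invariant : forall i, left_invariant (X i).
Hypothesis phi_differentiable : differentiableC phi.
Implicit Types (g h : G) (psi : G -> K[i]).

Lemma normc_real (a : K) : normc (Complex a 0) = `|a|.
Proof. by rewrite /normc expr0n addr0 sqrtr_sqr. Qed.

Lemma orbit_translate g : orbit_space phi (fun h => phi (g * h)%g).
Proof.
exists 1%N, (fun=> 1), (fun=> g).
by apply/funext => h; rewrite big_ord1 mul1r.
Qed.

Lemma orbit_self : orbit_space phi phi.
Proof.
by have := orbit_translate 1%g; under eq_fun do rewrite mul1g.
Qed.

Lemma orbit0 : orbit_space phi (fun=> 0).
Proof.
by exists 0%N, (fun=> 0), (fun=> 1%g); apply/funext => h; rewrite big_ord0.
Qed.

Lemma orbit_scale a psi : orbit_space phi psi ->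
  orbit_space phi (fun h => a * psi h).
Proof.
move=> [m [b [g ->]]]; exists m, (fun j => a * b j), g.
by apply/funext => h; rewrite mulr_sumr; apply: eq_bigr => j _; rewrite mulrA.
Qed.

Lemma orbit_add psi1 psi2 : orbit_space phi psi1 -> orbit_space phi psi2 ->
  orbit_space phi (fun h => psi1 h + psi2 h).
Proof.
move=> [m1 [b1 [g1 ->]]] [m2 [b2 [g2 ->]]].
exists (m1 + m2)%N,
  (fun j => match fintype.split j with inl j => b1 j | inr j => b2 j end),
  (fun j => match fintype.split j with inl j => g1 j | inr j => g2 j end).
apply/funext => h; rewrite big_split_ord/=; congr (_ + _);
  apply: eq_bigr => j _.
  by rewrite (unsplitK (inl j)).
by rewrite (unsplitK (inr j)).
Qed.

Lemma orbit_differentiableC psi : orbit_space phi psi -> differentiableC psi.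
Proof.
move=> [m [b [g ->]]]; apply: differentiableC_sum => j.
by apply: differentiableC_scale; exact: differentiableC_mulgl.
Qed.

Lemma lie_derivative_le_Psi (p : K) i psi : Psi X phi = p%:E ->
  orbit_space phi psi -> normc (psi 1%g) <= 1 ->
  normc (lie_derivative (X i) psi 1%g) <= p.
Proof.
move=> Pp opsi psi1; rewrite -lee_fin -Pp /Psi.
apply: le_trans (le_bigmax _ _ i).
by apply: ereal_sup_ubound; exists psi.
Qed.

Lemma Psi_ge0 : (0 <= Psi X phi)%E.
Proof. exact: bigmax_ge_id. Qed.

(* Finiteness of Psi forces the functional [psi |-> (X_i psi)(1)] to vanish on the
   kernel of the evaluation at 1, hence to be a multiple of it; by left
   invariance phi is then an eigenfunction of every X_i. *)
Lemma Psi_finite_eigen (p : K) i : Psi X phi = p%:E ->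
  exists2 lam : K[i], normc lam <= p &
    lie_derivative (X i) phi = fun g => lam * phi g.
Proof.
move=> Pp.
have p0 : 0 <= p by rewrite -lee_fin -Pp Psi_ge0.
have [phi0|/existsNP[g0 /eqP phig0]] := pselect (forall g, phi g = 0).
  exists 0; first by rewrite normc0.
  have -> : phi = fun=> 0 by exact/funext.
  by rewrite lie_derivative0; apply/funext => g; rewrite mulr0.
(* An element of the orbit space with value 1 at the unit; its derivative there is the
   eigenvalue. *)
pose psi0 h := (phi g0)^-1 * phi (g0 * h)%g.
have opsi0 : orbit_space phi psi0 by apply: orbit_scale; exact: orbit_translate.
have psi01 : psi0 1%g = 1 by rewrite /psi0 mulg1 mulVf.
exists (lie_derivative (X i) psi0 1%g).
  by apply: lie_derivative_le_Psi => //; rewrite psi01 normc1.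
apply/funext => g.
(* The translate of [phi] by [g], corrected to vanish at the unit. *)
pose psi h := phi (g * h)%g + (- phi g) * psi0 h.
have opsi : orbit_space phi psi.
  by apply: orbit_add; [exact: orbit_translate|exact: orbit_scale].
have psi1 : psi 1%g = 0 by rewrite /psi psi01 mulg1 mulr1 subrr.
have dpsi := orbit_differentiableC opsi.
have Lpsi : lie_derivative (X i) psi 1%g = 0.
  apply: eq0_normc; apply/eqP; rewrite eq_le normc_ge0 andbT leNgt.
  apply/negP => l0.
  set l := normc _ in l0.
  (* Scaling keeps the value 0 at the unit, hence the constraint in [Psi], but raises the derivative
     to modulus [p + 1 > p]. *)
  pose t := Complex ((p + 1) / l) 0.
  have := @lie_derivative_le_Psi p i (fun h => t * psi h) Pp (orbit_scale _ opsi).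
  rewrite psi1 mulr0 normc0 => /(_ ler01).
  rewrite lie_derivative_scale// normcM normc_real ger0_norm; last first.
    by rewrite divr_ge0 ?addr_ge0// ltW.
  by rewrite divfK ?gt_eqF// gerDl ler10.
move: Lpsi; rewrite /psi lie_derivative_add; last 2 first.
- exact: differentiableC_mulgl.
- by apply: differentiableC_scale; exact: orbit_differentiableC.
rewrite lie_derivative_mulgl// mulg1 lie_derivative_scale; last first.
  exact: orbit_differentiableC.
by rewrite mulNr => /eqP; rewrite subr_eq0 mulrC => /eqP.
Qed.

(** Each field multiplies [phi] by a scalar of modulus at most [p]. *)
Lemma lie_derivatives_eigen_bound (p : K) alpha : Psi X phi = p%:E ->
  normc (lie_derivatives X alpha phi 1%g) <= p ^+ size alpha * normc (phi 1%g).
Proof.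
move=> Pp; have p0 : 0 <= p by rewrite -lee_fin -Pp Psi_ge0.
have [mu mup ->] : exists2 mu : K[i], normc mu <= p ^+ size alpha &
    lie_derivatives X alpha phi = fun g => mu * phi g.
  elim: alpha => [|i alpha [mu mup IH]].
    exists 1; first by rewrite normc1.
    by apply/funext => g; rewrite mul1r.
  have [lam lamp Ei] := Psi_finite_eigen i Pp.
  exists (mu * lam).
    by rewrite normcM exprSr ler_pM// normc_ge0.
  by rewrite /= IH lie_derivative_scale// Ei; apply/funext => g; rewrite mulrA.
by rewrite normcM ler_wpM2r// normc_ge0.
Qed.

Lemma qnorm_term_ge0 (r c : K) k : 0 <= c ->
  0 <= k`!%:R `^ (r - 1) * c ^+ k *
     \sum_(alpha : k.-tuple 'I_n) normc (lie_derivatives X alpha phi 1%g).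
Proof.
move=> c0; rewrite mulr_ge0//; last by apply: sumr_ge0 => ? _; exact: normc_ge0.
by rewrite mulr_ge0 ?powR_ge0// exprn_ge0.
Qed.

Lemma sum_tuple_le (k : nat) (C : K) :
  (forall alpha : k.-tuple 'I_n, normc (lie_derivatives X alpha phi 1%g) <= C) ->
  \sum_(alpha : k.-tuple 'I_n) normc (lie_derivatives X alpha phi 1%g)
    <= C * n%:R ^+ k.
Proof.
move=> XC; apply: (@le_trans _ _ (\sum_(alpha : k.-tuple 'I_n) C)).
  by apply: ler_sum => al _; exact: XC.
by rewrite sumr_const card_tuple card_ord -natrX mulr_natr.
Qed.

Lemma qnorm_lt_pinfty (r c : K) : finite_rank (fun g h : G => phi (g * h)%g) ->
  r < 1 -> 0 <= c -> (qnorm X r c phi < +oo)%E.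
Proof.
move=> phi_rank r1 c0.
have [C [M [C0 M0 CM]]] :=
  lie_derivatives_bound X_left_invariant phi_differentiable phi_rank.
(* [M] comes from the growth of the derivatives and [n] from the [n ^ k] words of length [k]. *)
pose u k := C * (k`!%:R `^ (r - 1) * (c * M * n%:R) ^+ k).
have cvgu : cvgn (series u).
  apply: is_cvg_seriesZ; apply: fact_powR_series_cvg => //.
  by rewrite !mulr_ge0.
apply: (@le_lt_trans _ _ (\sum_(0 <= k <oo) (u k)%:E)%E).
  apply: lee_nneseries => k _; first by rewrite lee_fin => _; exact: qnorm_term_ge0.
  have /sum_tuple_le : forall al : k.-tuple 'I_n,
      normc (lie_derivatives X al phi 1%g) <= C * M ^+ k.
    by move=> al; have := CM al; rewrite size_tuple.
  move=> kle; rewrite lee_fin.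
  apply: (le_trans (ler_wpM2l _ kle)).
    by rewrite mulr_ge0 ?powR_ge0// exprn_ge0.
  by rewrite /u !exprMn le_eqVlt; apply/orP; left; apply/eqP; ring.
have -> : (\sum_(0 <= k <oo) (u k)%:E)%E = (limn (series u))%:E.
  by rewrite -EFin_lim//; congr (limn _); apply/funext => k /=; rewrite sumEFin.
exact: ltry.
Qed.

(** * The explicit estimate for a norm on the orbit space *)

Section norm_bound.
Variable N : (G -> K[i]) -> K.
Hypothesis N_norm : norm_on (orbit_space phi) N.

Lemma norm_on0 : N (fun=> 0) = 0.
Proof.
have [_ _ NZ _] := N_norm.
have := NZ 0 _ orbit_self; rewrite normc0 mul0r => <-.
by congr N; apply/funext => g; rewrite mul0r.
Qed.

Lemma Delta_ge0 : (0 <= Delta N phi)%E.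
Proof.
apply: ereal_sup_ubound; exists (fun=> 0); last by rewrite normc0.
by split; [exact: orbit0|rewrite /= norm_on0].
Qed.

Lemma eval1_le_Delta psi : orbit_space phi psi ->
  ((normc (psi 1%g))%:E <= Delta N phi * (N psi)%:E)%E.
Proof.
move=> opsi; have [N0 N00 NZ _] := N_norm.
(* If [N psi = 0] then [psi = 0], and the right side is 0 even for infinite [Delta]; otherwise [psi]
   is rescaled to norm 1. *)
have [/(N00 _ opsi) ->|Npsi] := eqVneq (N psi) 0.
  by rewrite normc0 norm_on0 mule0.
have Np : 0 < N psi by rewrite lt0r Npsi N0.
rewrite -lee_pdivrMr// -EFinM.
apply: ereal_sup_ubound; exists (fun h => Complex (N psi)^-1 0 * psi h) => /=.
  split; first exact: orbit_scale.
  by rewrite /= NZ// normc_real gtr0_norm ?invr_gt0// mulVf.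
by rewrite normcM normc_real gtr0_norm ?invr_gt0// mulrC.
Qed.

Local Notation weight r k := ((k`!%:R `^ (r - 1))%:E).

(** Since [|phi(1)|] is at most [Delta * N phi], a termwise comparison with [|phi(1)|] in front
    suffices. The ratio [T] may be infinite. *)
Lemma qnorm_le_of_terms (r c : K) (T : \bar K) : 0 <= c -> (0 <= T)%E ->
  (forall k, ((k`!%:R `^ (r - 1) * c ^+ k *
     \sum_(alpha : k.-tuple 'I_n) normc (lie_derivatives X alpha phi 1%g))%:E
     <= (normc (phi 1%g))%:E * (weight r k * T ^+ k))%E) ->
  (qnorm X r c phi <=
    Delta N phi * (N phi)%:E * \sum_(0 <= k <oo) weight r k * T ^+ k)%E.
Proof.
move=> c0 T0 le_terms.
have w0 k : (0 <= weight r k * T ^+ k)%E.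
  by rewrite mule_ge0 ?lee_fin ?powR_ge0// expe_ge0.
apply: (@le_trans _ _ ((normc (phi 1%g))%:E *
    \sum_(0 <= k <oo) weight r k * T ^+ k)%E); last first.
  apply: lee_wpmul2r; first exact: nneseries_ge0.
  exact: eval1_le_Delta orbit_self.
rewrite -nneseriesZl//; apply: lee_nneseries => // k _ _.
by rewrite lee_fin; exact: qnorm_term_ge0.
Qed.

Lemma qnorm_le_finite_Psi (r c p : K) : 0 <= c -> Psi X phi = p%:E ->
  (qnorm X r c phi <= Delta N phi * (N phi)%:E *
    \sum_(0 <= k <oo) weight r k * (c%:E * Psi X phi * n%:R%:E) ^+ k)%E.
Proof.
move=> c0 Pp; have p0 : 0 <= p by rewrite -lee_fin -Pp Psi_ge0.
rewrite Pp -!EFinM; apply: qnorm_le_of_terms => // [|k].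
  by rewrite lee_fin !mulr_ge0.
have /sum_tuple_le kle : forall al : k.-tuple 'I_n,
    normc (lie_derivatives X al phi 1%g) <= p ^+ k * normc (phi 1%g).
  by move=> al; have := lie_derivatives_eigen_bound al Pp; rewrite size_tuple.
rewrite -EFin_expe -!EFinM lee_fin.
apply: (le_trans (ler_wpM2l _ kle)).
    by rewrite mulr_ge0 ?powR_ge0// exprn_ge0.
by rewrite !exprMn le_eqVlt; apply/orP; left; apply/eqP; ring.
Qed.

(** For infinite [Psi], the cases [c = 0] and [phi = 0] are compared termwise; in all others the
    prefactor is positive and the series diverges. *)
Lemma qnorm_le (r c : K) : 0 <= c ->
  (qnorm X r c phi <= Delta N phi * (N phi)%:E *
    \sum_(0 <= k <oo) weight r k * (c%:E * Psi X phi * n%:R%:E) ^+ k)%E.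
Proof.
move=> c0; have := Psi_ge0.
case Pp : (Psi X phi) => [p| |] // _.
  by rewrite -Pp; exact: qnorm_le_finite_Psi Pp.
(* With [0 * +oo = 0] and [0 ^+ 0 = 1], only the terms of index 0 survive on both sides. *)
have [c00|cn0] := eqVneq c 0.
  rewrite c00 !mul0e; apply: qnorm_le_of_terms => // -[|k].
    rewrite !expr0 fact0 powR1 expe0 !mul1r !mule1 lee_fin.
    have /sum_tuple_le : forall al : 0.-tuple 'I_n,
      normc (lie_derivatives X al phi 1%g) <= normc (phi 1%g).
      by move=> al; rewrite tuple0.
    by rewrite expr0 mulr1.
  rewrite exprS !(mul0r, mulr0) mule_ge0 ?lee_fin ?normc_ge0//.
  by apply: mule_ge0; [rewrite lee_fin powR_ge0|exact: expe_ge0].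
have [phi0|/existsNP[g0 /eqP phig0]] := pselect (forall g, phi g = 0).
  apply: qnorm_le_of_terms => // [|k].
    by rewrite !mule_ge0 ?lee_fin.
  rewrite phi0 normc0 mul0e lee_fin.
  have -> : phi = fun=> 0 by exact/funext.
  rewrite big1 ?mulr0// => al _.
  rewrite (_ : lie_derivatives X al _ = fun=> 0) ?normc0//.
  by elim: (tval al) => //= i s ->; rewrite lie_derivative0.
(* For [n = 0] the maximum defining [Psi] is empty, hence 0 rather than [+oo]. *)
have n0 : 0 < n%:R :> K.
  rewrite ltr0n lt0n; apply/eqP => nz; have : (Psi X phi <= 0)%E.
    by apply/bigmax_leP; split=> // i; have := ltn_ord i; rewrite [X in (_ < X)%N]nz.
  by rewrite Pp.
have cp : 0 < c by rewrite lt0r cn0.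
have Np psi h : orbit_space phi psi -> psi h != 0 -> 0 < N psi.
  move=> opsi psih; have [N0 N00 _ _] := N_norm; rewrite lt0r N0// andbT.
  by apply: contra_neq psih => /(N00 _ opsi) ->.
(* Tested on the translate by [g0], because [phi] itself may vanish at the unit. *)
have D0 : (0 < Delta N phi)%E.
  have := eval1_le_Delta (orbit_translate g0); rewrite mulg1 => le0.
  rewrite lt_neqAle Delta_ge0 andbT; apply/eqP => D0; move: le0.
  rewrite -D0 mul0e lee_fin leNgt lt0r normc_ge0 andbT => /negP; apply.
  by apply: contra_neq phig0 => /eq0_normc.
have Tpinfty : (c%:E * +oo * n%:R%:E = +oo :> \bar K)%E.
  by rewrite gt0_muley ?lte_fin// gt0_mulye ?lte_fin.
(* The term of index 1 is already infinite, whereas that of index 0 is finite. *)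
rewrite (@nneseries_pinfty _ _ _ 1%N)//.
- by rewrite gt0_muley ?leey// mule_gt0// lte_fin (Np _ _ orbit_self phig0).
- move=> k _; rewrite Tpinfty; apply: mule_ge0; first by rewrite lee_fin powR_ge0.
  exact: expe_ge0.
- by rewrite Tpinfty powR1 mul1e.
Qed.

End norm_bound.
End seminorm_estimate.

Theorem theorem4p23 (K : realType) (n : nat) (G : lieGroupType K n)
    (e : 'I_n -> tangent (1%g : G)) (X : 'I_n -> vector_field G)
    (r : K) (phi : G -> K[i]) :
  connected [set: G] ->
  tangent_basis e ->
  (forall i, left_invariant (X i) /\ X i 1%g = e i) ->
  r < 1 ->
  analytic_fun phi ->
  representative phi ->
  entire X r phi /\
  forall N : (G -> K[i]) -> K, norm_on (orbit_space phi) N ->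
  forall c : K, 0 <= c ->
    (qnorm X r c phi <=
       Delta N phi * (N phi)%:E *
       \sum_(0 <= k <oo)
         (k`!%:R `^ (r - 1))%:E * (c%:E * Psi X phi * n%:R%:E) ^+ k)%E.
Proof.
move=> _ _ Xe r1 phi_analytic phi_rep.
have X_inv i : left_invariant (X i) by have [] := Xe i.
have phi_diff := analytic_fun_differentiableC phi_analytic.
split; last by move=> N N_norm c c0; exact: qnorm_le.
split=> // c c0; apply: qnorm_lt_pinfty => //.
exact: representative_finite_rank.
Qed.
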